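(* Let $d \geq 1$ be an integer, let $S \subset \mathbb{Z}^d \setminus \{0\}$ be a finite nonempty set, and let $a_k \in \mathbb{C}$ for $k \in S$ be such that the trigonometric polynomial $$ f(x) = \sum_{k \in S} a_{k} \exp\left(2 \pi i \left\langle x, k \right\rangle\right)$$ is real-valued on $\mathbb{T}^d$ (it has mean value $0$ since $0 \notin S$). Let $\Lambda = \left\{ \|k\| : k \in S \right\} \subset (0,\infty)$ be the set of distinct frequencies. Then $f$ has a zero in each ball in $\mathbb{T}^d$ of radius $$ r(f) = d^{3/2} \sum_{\lambda \in \Lambda} \frac{1}{\lambda}.$$
   Context: $\mathbb{T}^d = \mathbb{R}^d/\mathbb{Z}^d \cong [0,1]^d$ is the flat torus with its quotient Euclidean distance; $\|k\|$ is the Euclidean norm and $\langle x,k\rangle$ the standard inner product. The set $\Lambda$ contains each value $\|k\|$ only once, so in the sum each frequency is counted once. The ball of radius $r$ centered at $x$ is the set of all points at distance at most $r$ from $x$. *)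

(* Defs.v *)
From HB Require Import structures.
From mathcomp Require Import all_boot all_order all_algebra.
From mathcomp Require Import finmap complex.
From mathcomp Require Import all_classical all_reals all_analysis.
From mathcomp Require Import ring.

Set Implicit Arguments.
Unset Strict Implicit.
Unset Printing Implicit Defensive.
Import Order.TTheory GRing.Theory Num.Theory.
Local Open Scope classical_set_scope.
Local Open Scope complex_scope.
Local Open Scope ring_scope.

Definition innerprod (R : realType) (d : nat) (x y : 'rV[R]_d) : R :=
  \sum_(i < d) x 0 i * y 0 i.

(* The norm that the library puts on matrices is the sup norm. *)
Definition enorm (R : realType) (d : nat) (x : 'rV[R]_d) : R :=
  Num.sqrt (innerprod x x).

Definition intvec (R : realType) (d : nat) (k : 'rV[int]_d) : 'rV[R]_d :=
  map_mx intr k.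
Arguments intvec R {d} k.

Definition cexp (R : realType) (z : R[i]) : R[i] :=
  let: a +i* b := z in (expR a * cos b) +i* (expR a * sin b).

Definition int_lattice (R : realType) (d : nat) : {pred 'rV[R]_d} :=
  fun x => [forall i, x 0 i \is a Num.int].
Arguments int_lattice R d : clear implicits.

Fact int_lattice_zmod_closed (R : realType) (d : nat) :
  zmod_closed (int_lattice R d).
Proof.
split=> [|x y /forallP xi /forallP yi]; apply/forallP => i.
  by rewrite mxE rpred0.
by rewrite !mxE rpredB.
Qed.

HB.instance Definition _ (R : realType) (d : nat) :=
  GRing.isZmodClosed.Build 'rV[R]_d (int_lattice R d)
    (@int_lattice_zmod_closed R d).

(* The quotient group R^d / Z^d; [\pi_(torus R d)] is the projection. *)
Notation torus R d := (Quotient.quot (int_lattice R d)).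

(* Distance between the cosets p and q, as subsets of R^d. *)
Definition torus_dist (R : realType) (d : nat) (p q : torus R d) : R :=
  inf [set enorm (x - y) | x in [set x | \pi_(torus R d)%qT x = p]
                         & y in [set y | \pi_(torus R d)%qT y = q]].

Definition torus_ball (R : realType) (d : nat) (p : torus R d) (r : R) :
  set (torus R d) := [set q | torus_dist p q <= r].

(* [repr p] is a representative in R^d of the coset [p]; by [trigpoly_pi] the
   value does not depend on its choice. *)
Definition trigpoly (R : realType) (d : nat) (S : {fset 'rV[int]_d})
    (a : 'rV[int]_d -> R[i]) (p : torus R d) : R[i] :=
  \sum_(k <- S)
    a k * cexp (2 * pi%:C * 'i * (innerprod (repr p) (intvec R k))%:C).

Lemma cexp_2piE (R : realType) (t : R) :
  cexp (2 * pi%:C * 'i * t%:C) = cos (t * (pi *+ 2)) +i* sin (t * (pi *+ 2)).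
Proof.
have -> : 2 * pi%:C * 'i * t%:C = 0 +i* (t * (pi *+ 2)) :> R[i].
  apply/eqP; rewrite eq_complex /=; apply/andP; split; apply/eqP; ring.
by rewrite /cexp expR0 !mul1r.
Qed.

Lemma cexp_2pi_int (R : realType) (t u : R) : t - u \is a Num.int ->
  cexp (2 * pi%:C * 'i * t%:C) = cexp (2 * pi%:C * 'i * u%:C).
Proof.
have key (n : nat) (s : R) :
    cexp (2 * pi%:C * 'i * (s + n%:R)%:C) = cexp (2 * pi%:C * 'i * s%:C).
  rewrite !cexp_2piE mulrDl [n%:R * _]mulr_natl.
  by rewrite (periodicn (@cosD2pi R)) (periodicn (@sinD2pi R)).
move=> /intrP[[n|n] tu].
  have -> : t = u + n%:R by rewrite -[t](subrK u) tu addrC.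
  exact: key.
have -> : u = t + n.+1%:R by rewrite -[u](subKr t) tu NegzE mulrNz opprK.
by rewrite key.
Qed.

Lemma trigpoly_pi (R : realType) (d : nat) (S : {fset 'rV[int]_d})
    (a : 'rV[int]_d -> R[i]) (x : 'rV[R]_d) :
  trigpoly S a (\pi_(torus R d)%qT x) =
  \sum_(k <- S) a k * cexp (2 * pi%:C * 'i * (innerprod x (intvec R k))%:C).
Proof.
apply: eq_bigr => k _; congr (_ * _); apply: cexp_2pi_int.
have /forallP xZ : repr (\pi_(torus R d)%qT x) - x \in int_lattice R d.
  by rewrite Quotient.idealrBE reprK.
rewrite /innerprod -sumrB rpred_sum // => i _.
have := xZ i; rewrite !mxE -mulrBl => xiZ.
by rewrite rpredM // intr_int.
Qed.

(* A set, so that a norm shared by several elements of [S] occurs once. *)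
Definition frequencies (R : realType) (d : nat) (S : {fset 'rV[int]_d}) :
  {fset R} := [fset enorm (intvec R k) | k in S]%fset.
Arguments frequencies R {d} S.

(* Main.v *)
(* Suppose f has no zero in a cube around x; by the intermediate value theorem
   we may assume that f > 0 there.  Convolving f with a positive measure carried
   by a cube of half-side s keeps it positive on the cube shrunk by s.  For each
   frequency l there is such a measure whose Fourier transform vanishes on
   |xi| = l: let phi be the product over the coordinates of cos (b t) cut off to
   [-s, s], with b s = pi / 2.  In each coordinate
   phi'' + b^2 phi = b (delta_s + delta_(-s)) >= 0, so Laplacian phi + d b^2 phi
   is a positive measure; its Fourier transform is (d b^2 - 4 pi^2 |xi|^2) times
   that of phi, and vanishes on |xi| = l when b = 2 pi l / sqrt d, that is
   s = sqrt d / (4 l).  Killing all the frequencies one after the other leaves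
   0, which is not positive.  The cubes add up to the half-side
   sqrt d / 4 * sum 1 / l, hence to the radius d / 4 * sum 1 / l. *)

Require Import Defs.
From mathcomp Require Import all_boot all_order all_algebra.
From mathcomp Require Import finmap complex.
From mathcomp Require Import all_classical all_reals all_analysis.
From mathcomp Require Import ring.

Set Implicit Arguments.
Unset Strict Implicit.
Unset Printing Implicit Defensive.
Import Order.TTheory GRing.Theory Num.Theory.
Import numFieldNormedType.Exports.
Local Open Scope classical_set_scope.
Local Open Scope complex_scope.
Local Open Scope ring_scope.

(** * The truncated cosine in one variable *)

(* [\int_0^t cos (c u) du] *)
Definition sinint (R : realType) (c t : R) : R :=
  if c == 0 then t else sin (c * t) / c.

Lemma sinint0 (R : realType) (c : R) : sinint c 0 = 0.
Proof. by rewrite /sinint mulr0 sin0 mul0r if_same. Qed.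

Lemma is_derive_sinint (R : realType) (c t : R) :
  is_derive t 1 (sinint c) (cos (c * t)).
Proof.
have [->|c0] := eqVneq c 0.
  rewrite mul0r cos0 (_ : sinint 0 = id); first exact: is_derive_id.
  by apply/funext => u; rewrite /sinint eqxx.
have -> : sinint c = c^-1 \*: (sin \o (c \*: id)).
  by apply/funext => u; rewrite /sinint (negbTE c0) mulrC.
apply: is_derive_eq.
by rewrite /= /GRing.scale /= mulr1 [cos _ * c]mulrC mulrA mulVf ?mul1r.
Qed.

Lemma is_derive_sum_seq (R : realType) (I : Type) (r : seq I) (f : I -> R -> R)
    (df : I -> R) (t : R) :
  (forall i, is_derive t 1 (f i) (df i)) ->
  is_derive t 1 (fun u => \sum_(i <- r) f i u) (\sum_(i <- r) df i).
Proof.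
move=> fP; elim: r => [|i r IH].
  rewrite big_nil (_ : (fun _ => _) = cst 0); first exact: is_derive_cst.
  by apply/funext => u; rewrite big_nil.
rewrite big_cons.
rewrite (_ : (fun _ => _) = f i + (fun u => \sum_(j <- r) f j u)).
  exact: is_deriveD.
by apply/funext => u; rewrite big_cons.
Qed.

(* [\int_(-s)^s cos (b t) cos (w t) dt] *)
Definition cosbump (R : realType) (b s w : R) : R :=
  sinint (w - b) s + sinint (w + b) s.

(* The Fourier side of [phi'' + b^2 phi = b (delta_s + delta_(-s))], where
   [phi] is [cos (b t)] cut off at its zeros [s] and [-s]. *)
Lemma cosbumpE (R : realType) (b s w : R) : b * s = pi / 2 ->
  (b ^+ 2 - w ^+ 2) * cosbump b s w = b * (2 * cos (w * s)).
Proof.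
move=> bs; rewrite /cosbump /sinint.
have Em : sin ((w - b) * s) = - cos (w * s) by rewrite mulrBl bs sinBpihalf.
have Ep : sin ((w + b) * s) = cos (w * s) by rewrite mulrDl bs sinDpihalf.
(* At [w = b] or [w = - b] a [sinint] takes its degenerate branch, but both sides vanish because
   [cos (b * s) = 0]. *)
have [wb|wb] := eqVneq (w - b) 0.
  have -> : w = b by apply/eqP; rewrite -subr_eq0 wb.
  by rewrite bs cos_pihalf subrr mul0r !mulr0.
have [wb'|wb'] := eqVneq (w + b) 0.
  have -> : w = - b by apply/eqP; rewrite -subr_eq0 opprK wb'.
  by rewrite mulNr bs cosN cos_pihalf sqrrN subrr mul0r !mulr0.
by rewrite Em Ep; field; rewrite wb wb'.
Qed.

(** The sum is the integral over [[-s, s]] of [cos (b * t)], positive inside, times the even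
    function assumed positive. The mean value theorem in the upper endpoint replaces integration. *)
Lemma sum_cosbump_gt0 (R : realType) (I : Type) (r : seq I) (c w : I -> R)
    (b s : R) : 0 < s -> b * s = pi / 2 ->
  (forall t, 0 < t < s -> 0 < \sum_(i <- r) c i * cos (w i * t)) ->
  0 < \sum_(i <- r) c i * cosbump b s (w i).
Proof.
move=> s0 bs cpos.
pose G t := \sum_(i <- r) c i * cosbump b t (w i).
pose dG t := \sum_(i <- r) c i * (cos ((w i - b) * t) + cos ((w i + b) * t)).
have GP (t : R) : is_derive t 1 G (dG t).
  apply: is_derive_sum_seq => i.
  have := is_deriveZ (c i)
    (is_deriveD (is_derive_sinint (w i - b) t) (is_derive_sinint (w i + b) t)).
  exact.
have Gc : {within `[0, s], continuous G}.
  by apply: derivable_within_continuous => t _; have [] := GP t.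
have [t ts] := MVT s0 (fun t _ => GP t) Gc.
have -> : G 0 = 0.
  by rewrite /G big1 // => i _; rewrite /cosbump !sinint0 addr0 mulr0.
rewrite !subr0 -/(G s) => ->; rewrite mulr_gt0 //.
have -> : dG t = 2 * cos (b * t) * \sum_(i <- r) c i * cos (w i * t).
  rewrite /dG mulr_sumr; apply: eq_bigr => i _.
  by rewrite !mulrDl mulNr cosB cosD; ring.
move: ts; rewrite in_itv /= => /andP[t0 ts].
rewrite mulr_gt0 ?cpos ?t0 // mulr_gt0 // cos_gt0_pihalf //.
have b0 : 0 < b by rewrite -(pmulr_lgt0 _ s0) bs divr_gt0 ?pi_gt0.
rewrite -bs ltr_pM2l // ts andbT (lt_trans (y := 0)) ?oppr_lt0 ?mulr_gt0 //.
Qed.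

(** * Plane waves and convolution along the coordinate directions *)

Definition phase (R : realType) (d : nat) (k : 'rV[int]_d) (x : 'rV[R]_d) : R :=
  innerprod x (intvec R k) * (pi *+ 2).

Lemma phaseD (R : realType) (d : nat) (k : 'rV[int]_d) (x y : 'rV[R]_d) :
  phase k (x + y) = phase k x + phase k y.
Proof.
rewrite /phase -mulrDl /innerprod -big_split /=; congr (_ * _).
by apply: eq_bigr => i _; rewrite mxE mulrDl.
Qed.

Lemma phaseZ (R : realType) (d : nat) (k : 'rV[int]_d) (t : R) (x : 'rV[R]_d) :
  phase k (t *: x) = t * phase k x.
Proof.
rewrite /phase mulrA /innerprod mulr_sumr; congr (_ * _).
by apply: eq_bigr => i _; rewrite mxE mulrA.
Qed.

Definition freq1 (R : realType) (d : nat) (k : 'rV[int]_d) (i : 'I_d) : R :=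
  (k 0 i)%:~R * (pi *+ 2).

Lemma phase_delta (R : realType) (d : nat) (k : 'rV[int]_d) (i : 'I_d) (t : R) :
  phase k (t *: delta_mx 0 i) = freq1 R k i * t.
Proof.
rewrite phaseZ mulrC /phase /innerprod (bigD1 i) //= big1 => [|j ji].
  by rewrite !mxE !eqxx mul1r addr0.
by rewrite !mxE (negbTE ji) mul0r.
Qed.

(** The real part of [z * exp (i * phase k x)]. *)
Definition wave (R : realType) (d : nat) (k : 'rV[int]_d) (z : R[i])
    (x : 'rV[R]_d) : R :=
  complex.Re z * cos (phase k x) - complex.Im z * sin (phase k x).

(** Averaging over [t] and [- t] cancels the part odd in [t], so that a symmetric measure acts on
    each wave by a real factor. *)
Lemma wave_sym (R : realType) (d : nat) (k : 'rV[int]_d) (z : R[i])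
    (x : 'rV[R]_d) (i : 'I_d) (t : R) :
  wave k z (x + t *: delta_mx 0 i) + wave k z (x + (- t) *: delta_mx 0 i) =
  wave k z x * (2 * cos (freq1 R k i * t)).
Proof.
rewrite /wave !phaseD !phase_delta mulrN !(cosD, sinD, cosN, sinN).
by ring.
Qed.

(** The real weights [w] are kept apart from the coefficients [a]: they accumulate the successive
    multipliers. *)
Definition wsum (R : realType) (d : nat) (S : seq 'rV[int]_d)
    (a : 'rV[int]_d -> R[i]) (w : 'rV[int]_d -> R) (x : 'rV[R]_d) : R :=
  \sum_(k <- S) w k * wave k (a k) x.

(* Multiplying each frequency component by [M (freq1 R k i)] is meant to be the
   convolution with a positive measure on [-s, s] in the direction [i]. *)
Definition positive_multiplier (R : realType) (d : nat) (s : R) (M : R -> R) :=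
  forall (S : seq 'rV[int]_d) (a : 'rV[int]_d -> R[i]) (w : 'rV[int]_d -> R)
    (x : 'rV[R]_d) (i : 'I_d),
  (forall t, `|t| <= s -> 0 < wsum S a w (x + t *: delta_mx 0 i)) ->
  0 < wsum S a (fun k => w k * M (freq1 R k i)) x.

Lemma wsum_sym (R : realType) (d : nat) (S : seq 'rV[int]_d)
    (a : 'rV[int]_d -> R[i]) (w : 'rV[int]_d -> R) (x : 'rV[R]_d) (i : 'I_d)
    (s t : R) :
  (forall t, `|t| <= s -> 0 < wsum S a w (x + t *: delta_mx 0 i)) ->
  `|t| <= s ->
  0 < \sum_(k <- S) w k * wave k (a k) x * (2 * cos (freq1 R k i * t)).
Proof.
move=> wpos ts.
have := addr_gt0 (wpos t ts) (wpos (- t) _); rewrite normrN => /(_ ts).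
rewrite /wsum -big_split /=.
by under eq_bigr do rewrite -mulrDr wave_sym (mulrA (w _)).
Qed.

(** The measure is a pair of unit point masses at [s] and [- s]. *)
Lemma positive_multiplier_cos (R : realType) (d : nat) (s : R) : 0 <= s ->
  positive_multiplier d s (fun w => 2 * cos (w * s)).
Proof.
move=> s0 S a w x i /(@wsum_sym _ _ _ _ _ _ _ _ s).
rewrite ger0_norm // lexx => /(_ isT).
by under eq_bigr do rewrite mulrAC.
Qed.

(** The measure has density [cos (b * t)] on [[-s, s]]. *)
Lemma positive_multiplier_cosbump (R : realType) (d : nat) (b s : R) :
  0 < s -> b * s = pi / 2 -> positive_multiplier d s (cosbump b s).
Proof.
move=> s0 bs S a w x i wpos.
have := @sum_cosbump_gt0 R _ S (fun k => w k * wave k (a k) x)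
  (fun k => freq1 R k i) b s s0 bs _.
rewrite /wsum; under [X in _ -> is_true (0 < X)]eq_bigr do rewrite mulrAC.
apply=> t /andP[t0 ts].
have := wsum_sym wpos (t := t); rewrite gtr0_norm // ltW // => /(_ isT).
under eq_bigr do rewrite mulrCA.
by rewrite -mulr_sumr pmulr_rgt0.
Qed.

(** The directions are convolved one at a time; the box is flat in the directions outside [l], and
    each induction step thickens one more. *)
Lemma wsum_prod_gt0 (R : realType) (d : nat) (s : R) (M : 'I_d -> R -> R)
    (S : seq 'rV[int]_d) (a : 'rV[int]_d -> R[i]) (l : seq 'I_d)
    (w : 'rV[int]_d -> R) (x : 'rV[R]_d) :
  (forall i, positive_multiplier d s (M i)) -> uniq l ->
  (forall v : 'rV[R]_d, (forall j, `|v 0 j| <= if j \in l then s else 0) ->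
     0 < wsum S a w (x + v)) ->
  0 < wsum S a (fun k => w k * \prod_(i <- l) M i (freq1 R k i)) x.
Proof.
move=> MP; elim: l w x => [|i l IH] w x /=.
  move=> _ /(_ 0); rewrite addr0 (_ : (fun k => _) = w).
    by apply=> j; rewrite mxE normr0.
  by apply/funext => k; rewrite big_nil mulr1.
move=> /andP[il ul] wpos.
rewrite (_ : (fun k => _) = fun k => w k * M i (freq1 R k i) *
    \prod_(j <- l) M j (freq1 R k j)); last first.
  by apply/funext => k; rewrite big_cons mulrA.
apply: IH => // v vP; apply: MP => t ts; rewrite -addrA; apply: wpos => j.
rewrite !mxE eqxx /= in_cons; have := vP j; have [->|ji] /= := eqVneq j i.
  by rewrite (negbTE il) normr_le0 => /eqP->; rewrite mulr1 add0r.
by rewrite mulr0 addr0.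
Qed.

(** * Removing the frequencies one by one *)

Lemma wsum_sum (R : realType) (d : nat) (S : seq 'rV[int]_d)
    (a : 'rV[int]_d -> R[i]) (I : Type) (r : seq I)
    (w : I -> 'rV[int]_d -> R) (x : 'rV[R]_d) :
  wsum S a (fun k => \sum_(i <- r) w i k) x = \sum_(i <- r) wsum S a (w i) x.
Proof.
by rewrite /wsum exchange_big; apply: eq_bigr => k _; rewrite mulr_suml.
Qed.

(** The measure is a sum over [i] of products with point masses in direction [i] and cosine bumps in
    the others. *)
Lemma annihilating_multiplier (R : realType) (d : nat) (l : R) : (0 < d)%N ->
  0 < l ->
  exists m : 'rV[int]_d -> R, (forall k, enorm (intvec R k) = l -> m k = 0) /\
    forall (S : seq 'rV[int]_d) (a : 'rV[int]_d -> R[i]) (w : 'rV[int]_d -> R)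
      (x : 'rV[R]_d),
    (forall v : 'rV[R]_d, (forall j, `|v 0 j| <= Num.sqrt d%:R / (4 * l)) ->
       0 < wsum S a w (x + v)) ->
    0 < wsum S a (fun k => w k * m k) x.
Proof.
move=> d0 l0; set s := _ / _.
have q0 : 0 < Num.sqrt d%:R :> R by rewrite sqrtr_gt0 ltr0n.
have q2 : Num.sqrt d%:R ^+ 2 = d%:R :> R by rewrite sqr_sqrtr.
have s0 : 0 < s by rewrite divr_gt0 ?mulr_gt0.
(* Chosen so that [d * b^2 = (2 * pi * l)^2]; then [s] is the first positive zero of
   [cos (b * t)]. *)
pose b := (pi : R) *+ 2 * l / Num.sqrt d%:R.
have b0 : 0 < b by rewrite divr_gt0 // mulr_gt0 // pmulrn_lgt0 // pi_gt0.
have bs : b * s = pi / 2.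
  by rewrite /b /s; field; rewrite !gt_eqF.
pose M (i j : 'I_d) : R -> R :=
  if j == i then fun w => 2 * cos (w * s) else cosbump b s.
pose m k := \sum_i \prod_j M i j (freq1 R k j).
exists m; split=> [k kl|S a w x wpos].
  (* The factor [b] lets [cosbumpE] turn each summand into [b^2 - w_i^2], where [w_i = freq1 R k i],
     times the same full product of bumps. *)
  apply: (mulfI (lt0r_neq0 b0)); rewrite mulr0 /m mulr_sumr.
  under eq_bigr => i _.
    rewrite (bigD1 i) //= {1}/M eqxx mulrA -cosbumpE // -mulrA.
    rewrite (eq_bigr (fun j => cosbump b s (freq1 R k j))); last first.
      by move=> j /negbTE ji; rewrite /M ji.
    rewrite -(bigD1 (op := *%R) i (P := xpredT)
      (F := fun j => cosbump b s (freq1 R k j))) //.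
    over.
  rewrite -mulr_suml sumrB sumr_const card_ord.
  suff -> : \sum_i freq1 R k i ^+ 2 = b ^+ 2 *+ d by rewrite subrr mul0r.
  have -> : b ^+ 2 *+ d = (pi *+ 2) ^+ 2 * l ^+ 2.
    by rewrite -mulr_natr -q2 /b; field; rewrite gt_eqF.
  rewrite -kl sqr_sqrtr; last by apply: sumr_ge0 => i _; rewrite -expr2 sqr_ge0.
  rewrite /innerprod mulr_sumr; apply: eq_bigr => i _.
  by rewrite /freq1 !mxE; ring.
rewrite (_ : (fun k => _) =
    fun k => \sum_i w k * \prod_j M i j (freq1 R k j)); last first.
  by apply/funext => k; rewrite mulr_sumr.
rewrite wsum_sum.
have Mpos i : 0 < wsum S a (fun k => w k * \prod_j M i j (freq1 R k j)) x.
  apply: (wsum_prod_gt0 (s := s)) (index_enum_uniq _) _ => [j|v vs].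
    rewrite /M; case: ifP => _; first exact: positive_multiplier_cos (ltW s0).
    exact: positive_multiplier_cosbump.
  by apply: wpos => j; have := vs j; rewrite mem_index_enum.
(* Since [0 < d], there is a summand to make the sum strictly positive. *)
rewrite (bigD1 (Ordinal d0)) //= ltr_pwDl //.
by apply: sumr_ge0 => i _; exact: ltW.
Qed.

(** Each induction step kills the weights of one norm and shrinks the box accordingly; once [L] is
    empty, all weights on [S] are zero. *)
Lemma wsum_not_gt0 (R : realType) (d : nat) (S : seq 'rV[int]_d)
    (a : 'rV[int]_d -> R[i]) (L : seq R) (w : 'rV[int]_d -> R) (x : 'rV[R]_d) :
  (0 < d)%N -> all (fun l => 0 < l) L ->
  (forall k, k \in S -> w k != 0 -> enorm (intvec R k) \in L) ->
  ~ (forall v : 'rV[R]_d,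
      (forall j, `|v 0 j| <= \sum_(l <- L) Num.sqrt d%:R / (4 * l)) ->
      0 < wsum S a w (x + v)).
Proof.
move=> d0; elim: L w => [|l L IH] w /=.
  move=> _ wL /(_ 0); rewrite /wsum big_nil big_seq big1 ?ltxx => [|k kS].
    by move=> H; suff: false by []; apply: H => j; rewrite mxE normr0.
  have [->|/(wL k kS)] := eqVneq (w k) 0; first by rewrite mul0r.
  by rewrite in_nil.
move=> /andP[l0 L0] wL wpos; have [m [ml mP]] := annihilating_multiplier d0 l0.
apply: (IH (fun k => w k * m k)) => // [k kS|v vL].
  rewrite mulf_eq0 negb_or => /andP[/(wL k kS)]; rewrite in_cons.
  by case/orP => // /eqP /ml ->; rewrite eqxx.
apply: mP => u ul; rewrite -addrA; apply: wpos => j.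
rewrite big_cons mxE addrC (le_trans (ler_normD _ _)) ?lerD //.
Qed.

(** * A zero in a box *)

Lemma continuous_wsum_line (R : realType) (d : nat) (S : seq 'rV[int]_d)
    (a : 'rV[int]_d -> R[i]) (w : 'rV[int]_d -> R) (x v : 'rV[R]_d) :
  continuous (fun t : R => wsum S a w (x + t *: v)).
Proof.
rewrite /wsum; elim: S => [|k S IH].
  by under eq_fun do rewrite big_nil; exact: cst_continuous.
under eq_fun do rewrite big_cons.
move=> t; apply: cvgD; last exact: IH.
have pc : {for t, continuous (fun u : R => phase k (x + u *: v))}.
  under [X in {for _, continuous X}]eq_fun do rewrite phaseD phaseZ.
  by apply: cvgD; [exact: cvg_cst|apply: cvgMr_tmp; exact: cvg_id].
apply: cvgMl_tmp; apply: cvgB; apply: cvgMr.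
  by apply: (cvg_comp _ _ pc); exact: continuous_cos.
by apply: (cvg_comp _ _ pc); exact: continuous_sin.
Qed.

Lemma wsum_zero_in_box (R : realType) (d : nat) (S : {fset 'rV[int]_d})
    (a : 'rV[int]_d -> R[i]) (x : 'rV[R]_d) : (0 < d)%N -> 0 \notin S ->
  exists2 v : 'rV[R]_d,
    forall j, `|v 0 j| <= \sum_(l <- frequencies R S) Num.sqrt d%:R / (4 * l)
    & wsum S a (fun=> 1) (x + v) = 0.
Proof.
move=> d0 S0; apply: contrapT => nz; set r := \sum_(l <- _) _ in nz.
pose box (v : 'rV[R]_d) := forall j, `|v 0 j| <= r.
have fpos : all (fun l : R => 0 < l) (frequencies R S).
  apply/allP => _ /imfsetP[k /= kS ->].
  have sq0 (i : 'I_d) : true -> 0 <= intvec R k 0 i * intvec R k 0 i.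
    by rewrite -expr2 sqr_ge0.
  rewrite /enorm sqrtr_gt0 lt_def (sumr_ge0 _ sq0) andbT.
  apply: contraNneq S0 => /eqP; rewrite psumr_eq0 // => /allP k0.
  suff -> : 0 = k by [].
  apply/rowP => i; have := k0 i (mem_index_enum i).
  by rewrite !mxE mulf_eq0 orbb intr_eq0 => /eqP.
have r0 : 0 <= r.
  rewrite /r big_seq sumr_ge0 // => l /(allP fpos) l0.
  by rewrite divr_ge0 ?sqrtr_ge0 // mulr_ge0 // ltW.
have nbox w : ~ (forall v, box v -> 0 < wsum S a w (x + v)).
  apply: wsum_not_gt0 => // k kS _; exact: in_imfset.
pose F v := wsum S a (fun=> 1) (x + v).
(* A change of sign between [0] and [v] would give a zero on the segment joining them, which lies in
   the box. *)
have same v : box v -> 0 < F 0 * F v.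
  move=> bv; rewrite ltNge; apply/negP => FF; apply: nz.
  pose g (t : R) := wsum S a (fun=> 1) (x + t *: v).
  have g01 : Num.min (g 0) (g 1) <= 0 <= Num.max (g 0) (g 1).
    rewrite /g scale0r scale1r -/(F 0) -/(F v) ge_min le_max.
    case: (ltgtP (F 0) 0) FF => [f0|f0|//].
      by rewrite nmulr_rle0 // => ->; rewrite orbT.
    by rewrite pmulr_rle0 // => ->; rewrite orbT.
  have gc : {within `[0, 1], continuous g}.
    by apply: continuous_subspaceT; exact: continuous_wsum_line.
  have [t] := IVT ler01 gc g01.
  rewrite in_itv /= => /andP[t0 t1] Ft; exists (t *: v) => // j.
  by rewrite mxE normrM ger0_norm // (le_trans _ (bv j)) // ler_piMl.
have /same : box 0 by move=> j; rewrite mxE normr0.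
rewrite -expr2 exprn_even_gt0 //= => F0.
(* The constant weight [F 0] treats both signs at once, as it turns [F] into [F 0 * F]. *)
apply: (nbox (fun=> F 0)) => v /same.
by rewrite /F /wsum mulr_sumr; under eq_bigr do rewrite mul1r.
Qed.

(** * Passage to the torus and to Euclidean balls *)

Lemma trigpoly_real_wsum (R : realType) (d : nat) (S : {fset 'rV[int]_d})
    (a : 'rV[int]_d -> R[i]) (x : 'rV[R]_d) :
  trigpoly S a (\pi_(torus R d)%qT x) \is Num.real ->
  trigpoly S a (\pi_(torus R d)%qT x) = (wsum S a (fun=> 1) x)%:C.
Proof.
move=> /RRe_real <-; congr (_%:C); rewrite trigpoly_pi raddf_sum.
apply: eq_bigr => k _; rewrite cexp_2piE mul1r /wave /phase.
by case: (a k).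
Qed.

Lemma torus_dist_le (R : realType) (d : nat) (x y : 'rV[R]_d) :
  torus_dist (\pi_(torus R d)%qT x) (\pi_(torus R d)%qT y) <= enorm (x - y).
Proof.
apply: ge_inf.
  by exists 0 => _ [u _ [v _ <-]]; exact: sqrtr_ge0.
by exists x => //; exists y.
Qed.

Lemma enorm_le_box (R : realType) (d : nat) (v : 'rV[R]_d) (r : R) :
  0 <= r -> (forall j, `|v 0 j| <= r) -> enorm v <= Num.sqrt d%:R * r.
Proof.
move=> r0 vr; rewrite -[r in leRHS]ger0_norm // -sqrtr_sqr -sqrtrM //.
rewrite ler_wsqrtr // mulr_natl -[d in leRHS]card_ord -sumr_const.
by apply: ler_sum => i _; rewrite -expr2 -real_normK ?num_real // lerXn2r.
Qed.

Theorem theorem1 (R : realType) (d : nat) (hd : (1 <= d)%N)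
    (S : {fset 'rV[int]_d}) (hS0 : 0 \notin S) (hS : S != fset0)
    (a : 'rV[int]_d -> R[i])
    (freal : forall p : torus R d, trigpoly S a p \is Num.real)
    (x : torus R d) :
  exists2 y : torus R d,
    torus_ball x (d%:R `^ (3 / 2) * \sum_(l <- frequencies R S) l^-1) y
    & trigpoly S a y = 0.
Proof.
have [v vr Fv] := wsum_zero_in_box a (repr x) hd hS0.
exists (\pi_(torus R d)%qT (repr x + v)); last first.
  by rewrite trigpoly_real_wsum // Fv.
rewrite /torus_ball /= -[x in torus_dist x _]reprK.
apply: le_trans (torus_dist_le _ _) _; rewrite opprD addrA subrr add0r.
set L := frequencies R S in vr *.
have L0 : 0 <= \sum_(l <- L) l^-1.
  rewrite big_seq sumr_ge0 // => _ /imfsetP[k _ ->].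
  by rewrite invr_ge0 sqrtr_ge0.
have rE : \sum_(l <- L) Num.sqrt d%:R / (4 * l) =
    Num.sqrt d%:R / 4 * \sum_(l <- L) l^-1.
  by rewrite mulr_sumr; apply: eq_bigr => l _; rewrite invfM mulrA.
rewrite rE in vr.
have c0 : 0 <= Num.sqrt d%:R / 4 * \sum_(l <- L) l^-1.
  by rewrite mulr_ge0 // divr_ge0 // sqrtr_ge0.
apply: (le_trans (enorm_le_box c0 _)) => [j|]; first by rewrite mxE normrN.
(* One [sqrt d] comes from the box, the other from its half-diagonal; then
   [d / 4 <= d <= d^(3/2)]. *)
rewrite !mulrA -expr2 sqr_sqrtr // ler_wpM2r //.
apply: (@le_trans _ _ (d%:R `^ 1)); last first.
  by rewrite ler_powR ?ler1n // ler_pdivlMr // mul1r ler_nat.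
by rewrite powRr1 // ler_piMr // invf_le1 // ler1n.
Qed.
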